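(* Fix an integer $t>1$, let $\mathcal B\subseteq\mathcal U$ be the subalgebra generated by $u_t$ and $d_t$, and let $I_{\mathcal B}=I\cap\mathcal B$. Then $I_{\mathcal B}$ equals the two-sided ideal $J_{\mathcal B}$ of $\mathcal B$ generated by \[ u_t^{i+1}d_t^{i}-u_t^{i+1}d_t^{i+1}u_t\quad\text{and}\quad u_t^{i}d_t^{i+1}-d_tu_t^{i+1}d_t^{i+1}\qquad (i\ge0). \]
   Context: A partition is a nonincreasing sequence of nonnegative integers with finite sum; $\lambda'_i$ denotes the number of boxes in column $i$. $\mathbf Y$ is the set of partitions, $\mathbf C[\mathbf Y]$ the vector space with basis $\mathbf Y$. $\mathcal U$ is the free associative $\mathbf C$-algebra on generators $u_i,d_i$ ($i\ge1$), acting on $\mathbf C[\mathbf Y]$ (products as compositions): $u_i(\lambda)$ is the partition obtained by adding a box to column $i$ if that is a partition, else $0$; $d_i(\lambda)$ is the partition obtained by removing a box from column $i$ if that is a partition, else $0$. $I$ is the two-sided ideal of elements of $\mathcal U$ acting as zero on $\mathbf C[\mathbf Y]$. $u_t^0=d_t^0=1$. *)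

(* Defs.v *)
From HB Require Import structures.
From mathcomp Require Import all_boot all_order all_algebra.
From mathcomp Require Import boolp classical_sets reals.
From mathcomp Require Import finmap complex monalg.

Set Implicit Arguments.
Unset Strict Implicit.
Unset Printing Implicit Defensive.

Import Order.TTheory GRing.Theory Num.Theory.
Local Open Scope classical_set_scope.
Local Open Scope ring_scope.

(* A partition is stored as the list of its nonzero parts, i.e. without the
   infinite tail of zeros. *)
Definition is_partition (s : seq nat) : bool := sorted geq s && (0%N \notin s).

Definition int_partition : Type := {s : seq nat | is_partition s}.
HB.instance Definition _ := Choice.on int_partition.

(* Columns are numbered from 1. *)
Definition column : Type := {i : nat | (0 < i)%N}.
HB.instance Definition _ := Choice.on column.

(* Row r meets column i exactly when its length is at least i. *)
Definition column_length (l : int_partition) (i : column) : nat :=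
  count (leq (sval i)) (val l).

Definition add_box (i : column) (l m : int_partition) : Prop :=
  forall j : column, column_length m j = (column_length l j + (j == i))%N.

Definition remove_box (i : column) (l m : int_partition) : Prop := add_box i m l.

(* The letters inl i and inr i name the generators u_i and d_i; the free
   algebra is the monoid algebra of the free monoid on these letters. *)
Definition letter : Type := (column + column)%type.
HB.instance Definition _ := Choice.on letter.

Notation CY K := {malg K[int_partition]}.
Notation UD K := {malg K[{fmonom letter}]}.

Section Action.
Variable K : comNzRingType.

Definition u (i : column) : UD K := << fmu (inl i : letter) >>.
Definition d (i : column) : UD K := << fmu (inr i : letter) >>.

(* A partition is determined by its column lengths, so the sets below have at
   most one element; xget returns it, and 0 when there is none. *)
Definition letter_basis (x : letter) (l : int_partition) : CY K :=
  match x with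
  | inl i => xget 0 [set (<< m >> : CY K) | m in add_box i l]
  | inr i => xget 0 [set (<< m >> : CY K) | m in remove_box i l]
  end.

Definition letter_act (x : letter) (v : CY K) : CY K :=
  \sum_(l <- msupp v) v@_l *: letter_basis x l.

(* Products act as compositions: the rightmost letter acts first. *)
Definition word_act (w : seq letter) (v : CY K) : CY K := foldr letter_act v w.

Definition act (x : UD K) (v : CY K) : CY K :=
  \sum_(w <- msupp x) x@_w *: word_act w v.

Definition annihilator : set (UD K) := [set x | forall v : CY K, act x v = 0].

End Action.
Arguments annihilator K : clear implicits.

Definition generated_subalgebra (K : pzRingType) (A : lalgType K) (G : set A) :
    set A :=
  smallest (fun S : set A => GRing.subalg_closed [pred x in S]) G.

Definition two_sided_ideal (A : pzRingType) (B J : set A) : Prop :=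
  [/\ J `<=` B, GRing.zmod_closed [pred x in J]
    & forall b x, B b -> J x -> J (b * x) /\ J (x * b)].

Definition generated_ideal (A : pzRingType) (B G : set A) : set A :=
  smallest (two_sided_ideal B) G.

Definition subalgB (K : comNzRingType) (t : column) : set (UD K) :=
  generated_subalgebra [set u K t; d K t].

Definition relations (K : comNzRingType) (t : column) : set (UD K) :=
  [set x | exists i : nat,
      x = u K t ^+ i.+1 * d K t ^+ i - u K t ^+ i.+1 * d K t ^+ i.+1 * u K t
   \/ x = u K t ^+ i * d K t ^+ i.+1 - d K t * u K t ^+ i.+1 * d K t ^+ i.+1].

Arguments subalgB K t : clear implicits.
Arguments relations K t : clear implicits.

(* Main.v *)
From Stdlib Require Import Setoid Morphisms.
From HB Require Import structures.
Require Import Defs.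
From mathcomp Require Import all_boot all_order all_algebra.
From mathcomp Require Import boolp classical_sets reals.
From mathcomp Require Import finmap complex monalg.
From mathcomp Require Import zify.

(* Write E_i = u^i d^i and F_j = d^j u^j.  The relations say that
   u E_i = E_(i+1) u and E_i d = d E_(i+1), so the E_i commute with the F_j, and
   every word in u, d becomes congruent to a word d^(n-h) u^n d^p, where p, h, n
   only depend on the lattice path read off the word from right to left.

   Conversely, on the partition with b rows of length t and N - b rows of length
   t - 1, a word with these parameters is the shift b -> b - p + h, defined when
   p <= b and n - p <= N - b.  If a combination of the words d^(n-h) u^n d^p
   vanishes, take a nonzero term with n minimal and let b = p, N = n: no other
   term contributes to the image with the same shift, a contradiction.

   The relations do hold on all partitions, because u and d act as mutually
   inverse partial injections. *)

Set Implicit Arguments.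
Unset Strict Implicit.
Unset Printing Implicit Defensive.

Import GRing.Theory.
Local Open Scope classical_set_scope.
Local Open Scope ring_scope.

(** * Lattice paths and canonical words *)

Local Notation ups n := (nseq n true).
Local Notation downs n := (nseq n false).

(* Reading a word from right to left as a lattice path (true is an up step for u,
   false a down step for d), (p, h, n) records the depth p of the minimum below
   the start, and the heights h of the end and n of the maximum above the
   minimum. *)
Definition extent_step (b : bool) (e : nat * nat * nat) : nat * nat * nat :=
  let: (p, h, n) := e in
  if b then (p, h.+1, maxn n h.+1)
  else if h is h'.+1 then (p, h', n) else (p.+1, 0, n.+1)%N.

Definition extent (w : seq bool) : nat * nat * nat :=
  foldr extent_step (0, 0, 0)%N w.

(** The simplest path with these parameters when p, h <= n: down to the minimum, up to the maximum,
    down to the end. *)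
Definition canonical_word (e : nat * nat * nat) : seq bool :=
  let: (p, h, n) := e in downs (n - h) ++ ups n ++ downs p.

Lemma extent_bounds w :
  let: (p, h, n) := extent w in (p <= n)%N && (h <= n)%N.
Proof.
elim: w => //= b w; case: (extent w) => [[p h] n] /=.
case: b => /=; first lia.
case: h => [|h]; lia.
Qed.

Lemma nseqSr (T : Type) n (x : T) : nseq n.+1 x = nseq n x ++ [:: x].
Proof. by rewrite -addn1 nseqD. Qed.

(** * Reduction of words modulo the relations *)

Section WordCongruence.
Variable r : seq bool -> seq bool -> Prop.
Hypothesis r_equiv : Equivalence r.
Hypothesis r_cat : Proper (r ==> r ==> r) cat.
Hypothesis r_up : forall i,
  r (ups i.+1 ++ downs i) (ups i.+1 ++ downs i.+1 ++ [:: true]).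
Hypothesis r_down : forall i,
  r (ups i ++ downs i.+1) ([:: false] ++ ups i.+1 ++ downs i.+1).

Local Notation E i := (ups i ++ downs i).
Local Notation F i := (downs i ++ ups i).

Let r_refl x : r x x. Proof. reflexivity. Qed.
#[local] Hint Resolve r_refl : core.

Lemma r_up_E i : r ([:: true] ++ E i) (E i.+1 ++ [:: true]).
Proof. by have := r_up i; rewrite -!catA. Qed.

Lemma r_E_down i : r (E i ++ [:: false]) ([:: false] ++ E i.+1).
Proof. by have := r_down i; rewrite nseqSr -!catA. Qed.

Lemma F_succ j : F j.+1 = [:: false] ++ F j ++ [:: true].
Proof. by rewrite (nseqSr j true) /= catA. Qed.

(** Write F_(j+1) = d F_j u: moving right, u turns E_i into E_(i+1), and d turns it back. Hence the
    induction on j is for all i at once. *)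
Lemma r_F_E i j : r (F j ++ E i) (E i ++ F j).
Proof.
elim: j i => [|j IHj] i; first by rewrite /= cats0.
rewrite F_succ -[X in r X _]catA -[(F j ++ _) ++ _]catA r_up_E.
rewrite [F j ++ E i.+1 ++ _]catA IHj -[(E i.+1 ++ _) ++ _]catA.
by rewrite [[:: false] ++ _]catA -r_E_down -[X in r X _]catA.
Qed.

(** An up step below the maximum: E_1 passes F_m and is absorbed by the next u, as E_1 u is
    congruent to u E_0 = u. *)
Lemma r_up_down_up m k :
  r ([:: true] ++ downs m.+1 ++ ups (m + k.+1)) (downs m ++ ups (m + k.+1)).
Proof.
have -> : [:: true] ++ downs m.+1 ++ ups (m + k.+1)
    = (E 1 ++ F m) ++ [:: true] ++ ups k.
  by rewrite nseqD /= -!catA.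
rewrite -r_F_E -catA [E 1 ++ _]catA -(r_up_E 0) nseqD -[ups k.+1]cat1s -!catA.
exact: r_refl.
Qed.

(** A down step below the minimum: E_1 passes F_n and is absorbed by d, as d E_1 is congruent to E_0
    d = d. *)
Lemma r_down_F n : r ([:: false] ++ F n) (F n.+1 ++ [:: false]).
Proof.
have -> : F n.+1 ++ [:: false] = [:: false] ++ F n ++ E 1.
  by rewrite F_succ -!catA.
rewrite (r_F_E 1 n) [X in r _ X]catA -(r_E_down 0) cats0.
reflexivity.
Qed.

Lemma r_canonical_word w : r w (canonical_word (extent w)).
Proof.
elim: w => [|b w IHw]; first exact: r_refl.
rewrite -cat1s {1}IHw /=.
have := extent_bounds w; case: (extent w) => [[p h] n] /= /andP[_ le_hn].
case: b => /=.
  (* At the maximum the new u lengthens the middle block; below it, it cancels a d of the left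
     block. *)
  have [->|ne_hn] := eqVneq h n.
    by rewrite maxnE subSnn addn1 !subnn /=.
  have -> : maxn n h.+1 = n by lia.
  have -> : (n - h = (n - h.+1).+1)%N by lia.
  have := r_cat (r_up_down_up (n - h.+1) h) (r_refl (downs p)).
  have -> : (n - h.+1 + h.+1 = n)%N by lia.
  by rewrite -!catA.
(* At height 0 all three blocks grow by one letter; otherwise the word is already canonical. *)
case: h le_hn => [|h] le_hn /=.
  have := r_cat (r_down_F n) (r_refl (downs p)).
  by rewrite !subn0 -!catA.
by have -> : (n - h = (n - h.+1).+1)%N by lia.
Qed.
End WordCongruence.

(** * Words as partial injections on partitions *)

Lemma column_eqE (i j : column) : (i == j) = (sval i == sval j).
Proof. by apply/eqP/eqP => [->|] //; apply: val_inj. Qed.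

(** The multiplicity of a part i is the difference of the lengths of columns i and i + 1, and sorted
    lists with equal multiplicities coincide. *)
Lemma column_length_inj (l m : int_partition) :
  (forall i, column_length l i = column_length m i) -> l = m.
Proof.
case: l m => [l pl] [m pm] eq_lm; apply: val_inj => /=.
have /andP[sl l0] := pl; have /andP[sm m0] := pm.
have geq_tr : transitive geq.
  by move=> x y z /= yx xz; apply: leq_trans xz yx.
apply: (sorted_eq geq_tr _ sl sm) => [x y /=|]; first by rewrite andbC -eqn_leq => /eqP.
apply/allP => -[|i] _ /=; first by rewrite (count_memPn l0) (count_memPn m0).
have countE s :
    count_mem i.+1 s = (count (leq i.+1) s - count (leq i.+2) s)%N.
  by elim: s => //= x s IHs; have := sub_count (fun x => @ltnW i.+1 x) s; lia.
rewrite !countE; have := eq_lm (exist _ i.+1 isT).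
by have := eq_lm (exist _ i.+2 isT); rewrite /column_length /= => -> ->.
Qed.

Section Walk.
Variable t : column.

Definition box_move (b : bool) (l m : int_partition) : Prop :=
  if b then add_box t l m else remove_box t l m.

(** [None] stands for the zero vector; [act_generator] translates back to the action. *)
Definition step (b : bool) (l : int_partition) : option int_partition :=
  xget None [set Some m | m in box_move b l].

Lemma box_move_sym b l m : box_move b l m <-> box_move (~~ b) m l.
Proof. by case: b. Qed.

Lemma box_move_unique b l m1 m2 : box_move b l m1 -> box_move b l m2 -> m1 = m2.
Proof.
by case: b => /= h1 h2; apply: column_length_inj => i;
  have := h1 i; have := h2 i; lia.
Qed.

Lemma stepP b l m : step b l = Some m <-> box_move b l m.
Proof.
rewrite /step; case: xgetP => [o -> [m' lm' <-]|none_l].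
  by split=> [[<-]|/(box_move_unique lm') ->].
by split=> // lm; case: (none_l (Some m)); exists m.
Qed.

Lemma step_None b l : (forall m, ~ box_move b l m) -> step b l = None.
Proof. by case E: (step b l) => [m|] // /(_ m); case; apply/stepP. Qed.

Definition walk (w : seq bool) (l : int_partition) : option int_partition :=
  foldr (fun b => obind (step b)) (Some l) w.

Lemma walk_cat w1 w2 l : walk (w1 ++ w2) l = obind (walk w1) (walk w2 l).
Proof.
elim: w1 => [|b w1 IHw] /=; first by case: (walk w2 l).
by rewrite IHw; case: (walk w2 l).
Qed.

(** The two letters are mutually inverse partial injections, so a word is inverted by reversing it
    and swapping its letters. *)
Lemma walk_rev w l m :
  walk w l = Some m <-> walk (rev (map negb w)) m = Some l.
Proof.
elim: w m => [|b w IHw] m; first by split=> -[->].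
rewrite map_cons rev_cons -cats1 walk_cat /=; split.
  case Ew: (walk w l) => [k|] //= /stepP/box_move_sym/stepP ->.
  exact/IHw.
case Eb: (step (~~ b) m) => [k|] //= /IHw -> /=.
by apply/stepP/box_move_sym/stepP.
Qed.

Lemma walk_up_down i l m :
  walk (ups i) l = Some m <-> walk (downs i) m = Some l.
Proof. by rewrite walk_rev map_nseq rev_nseq. Qed.

Lemma option_ext (T : Type) (a b : option T) :
  (forall x, a = Some x <-> b = Some x) -> a = b.
Proof.
case: a => [x|] ab; first by apply/esym/ab.
by case: b ab => // y /(_ y)[_ ->].
Qed.

(** Both sides are u restricted to the domain of d^i, because u^i undoes d^i and d undoes u. *)
Lemma walk_r_up i l :
  walk (ups i.+1 ++ downs i) l = walk (ups i.+1 ++ downs i.+1 ++ [:: true]) l.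
Proof.
apply: option_ext => m.
rewrite (nseqSr i false) -!catA !walk_cat [X in obind (walk [:: false]) X]/=.
split.
  case Ed: (walk (downs i) l) => [k|//] um.
  have lm : step true l = Some m by move: um; rewrite /= (walk_up_down i k l).2.
  have ml : step false m = Some l by apply/stepP/box_move_sym/stepP.
  by rewrite lm [X in obind (walk (downs i)) X]/= ml -um -Ed.
case Eu: (step true l) => [k|] //=.
by have /stepP/(box_move_sym true)/stepP /= -> := Eu.
Qed.

(** Both sides are d restricted to the domain of d^(i+1). *)
Lemma walk_r_down i l :
  walk (ups i ++ downs i.+1) l = walk ([:: false] ++ ups i.+1 ++ downs i.+1) l.
Proof.
apply: option_ext => m; rewrite catA !walk_cat.
case Ed: (walk (downs i.+1) l) => [k|] //=.
have /walk_up_down := Ed => /=.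
case Eu: (walk (ups i) k) => [k'|] //= /stepP/(box_move_sym true)/stepP /= uk'.
have /stepP/(box_move_sym false)/stepP /= -> := uk'.
by rewrite /= uk'.
Qed.

(** * Near rectangles as test partitions *)

Hypothesis ht : (1 < sval t)%N.

(** For b <= N, column t has b boxes and is bounded by the N boxes of column t - 1, so b can range
    over 0, ..., N. As t > 1, the shorter rows are nonzero parts. *)
Definition near_rectangle_seq (b N : nat) : seq nat :=
  nseq b (sval t) ++ nseq (N - b) (sval t).-1.

Lemma near_rectangle_partition b N : is_partition (near_rectangle_seq b N).
Proof.
rewrite /is_partition /near_rectangle_seq mem_cat !mem_nseq; apply/andP; split; last by lia.
have geq_tr : transitive geq.
  by move=> x y z /= yx xz; apply: leq_trans xz yx.
rewrite sorted_pairwise // pairwise_cat; apply/and3P; split.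
- by apply/allrelP => x y; rewrite !mem_nseq => /andP[_ /eqP->] /andP[_ /eqP->] /=; lia.
- by elim: b => //= b ->; rewrite andbT all_nseq /= leqnn orbT.
- by elim: (N - b)%N => //= k ->; rewrite andbT all_nseq /= leqnn orbT.
Qed.

Definition near_rectangle (b N : nat) : int_partition :=
  exist _ (near_rectangle_seq b N) (near_rectangle_partition b N).

Lemma column_length_near_rectangle b N i : column_length (near_rectangle b N) i =
  ((sval i <= sval t) * b + (sval i < sval t) * (N - b))%N.
Proof.
rewrite /column_length /= /near_rectangle_seq count_cat !count_nseq; congr (_ + _ * _)%N.
by congr nat_of_bool; lia.
Qed.

Lemma near_rectangle_inj b b' N : near_rectangle b N = near_rectangle b' N -> b = b'.
Proof.
move=> /(congr1 (column_length ^~ t)).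
by rewrite !column_length_near_rectangle leqnn ltnn; lia.
Qed.

Lemma add_box_near_rectangle b N : (b < N)%N ->
  add_box t (near_rectangle b N) (near_rectangle b.+1 N).
Proof.
move=> ltbN j; rewrite !column_length_near_rectangle column_eqE.
by case: ltngtP => _ /=; lia.
Qed.

Lemma step_up_near_rectangle b N : (b <= N)%N -> step true (near_rectangle b N) =
  if (b < N)%N then Some (near_rectangle b.+1 N) else None.
Proof.
move=> lebN; case: ifP => ltbN; first exact/stepP/add_box_near_rectangle.
(* Here b = N, and a further box would make column t longer than column t - 1. *)
apply: step_None => m /= lm; have t1 : (0 < (sval t).-1)%N by lia.
have := lm t; have := lm (exist _ (sval t).-1 t1).
rewrite !column_length_near_rectangle !column_eqE /= /column_length /=.
have := @sub_count _ (leq (sval t)) (leq (sval t).-1) _ (sval m).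
move=> /(_ ltac:(by move=> x /=; lia)).
rewrite leqnn ltnn eqxx leq_pred.
have -> : ((sval t).-1 < sval t)%N by lia.
have -> : ((sval t).-1 == sval t) = false by lia.
by rewrite /=; lia.
Qed.

Lemma step_down_near_rectangle b N : (b <= N)%N -> step false (near_rectangle b N) =
  if b is b'.+1 then Some (near_rectangle b' N) else None.
Proof.
case: b => [|b] lebN; last exact/stepP/add_box_near_rectangle.
apply: step_None => m /= /(_ t).
by rewrite column_length_near_rectangle eqxx; lia.
Qed.

(** Column t follows the lattice path started at height b, which must stay between 0 and N; its
    minimum is b - p and its maximum b - p + n. The second bound is stated additively to avoid
    truncated subtraction. *)
Lemma walk_near_rectangle w b N : (b <= N)%N ->
  walk w (near_rectangle b N) = let: (p, h, n) := extent w in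
  if (p <= b)%N && (b + n <= N + p)%N then Some (near_rectangle (b - p + h) N)
  else None.
Proof.
move=> lebN; elim: w => [|c w IHw] /=; first by rewrite !addn0 lebN subn0.
rewrite IHw; have := extent_bounds w; case: (extent w) => [[p h] n] /=.
move=> /andP[lepn lehn]; case: c => /=.
  case: ifP => /= [|] cond; last by case: ifP => //; lia.
  rewrite step_up_near_rectangle; last lia.
  by rewrite addnS; do 2 case: ifP => //; lia.
case: h lehn => [|h] lehn; case: ifP => /= [|] cond //.
- rewrite step_down_near_rectangle; last lia.
  case: ifP => cond'; last by have -> : (b - p + 0 = 0)%N by lia.
  have -> : (b - p + 0 = (b - p.+1).+1)%N by lia.
  by rewrite addn0.
- by case: ifP => //; lia.
- by rewrite step_down_near_rectangle ?addnS //; lia.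
Qed.
End Walk.

(** * Generated subalgebras and ideals *)

Lemma zmod_closedP (V : zmodType) (J : set V) :
  GRing.zmod_closed [pred x in J] <->
  J 0 /\ (forall x y, J x -> J y -> J (x - y)).
Proof.
split=> [[J0 JB]|[J0 JB]]; split.
- exact: set_mem J0.
- by move=> x y /mem_set Jx /mem_set Jy; exact: set_mem (JB x y Jx Jy).
- exact: mem_set J0.
- by move=> x y /set_mem Jx /set_mem Jy; exact: mem_set (JB x y Jx Jy).
Qed.

Lemma subalg_closedP (K : pzRingType) (A : lalgType K) (S : set A) :
  GRing.subalg_closed [pred x in S] <->
  [/\ S 1, (forall a x y, S x -> S y -> S (a *: x + y))
     & (forall x y, S x -> S y -> S (x * y))].
Proof.
split=> [[S1 SD SM]|[S1 SD SM]]; split.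
- exact: set_mem S1.
- by move=> a x y /mem_set Sx /mem_set Sy; exact: set_mem (SD a x y Sx Sy).
- by move=> x y /mem_set Sx /mem_set Sy; exact: set_mem (SM x y Sx Sy).
- exact: mem_set S1.
- by move=> a x y /set_mem Sx /set_mem Sy; exact: mem_set (SD a x y Sx Sy).
- by move=> x y /set_mem Sx /set_mem Sy; exact: mem_set (SM x y Sx Sy).
Qed.

Lemma generated_subalgebra_closed (K : pzRingType) (A : lalgType K) (G : set A) :
  GRing.subalg_closed [pred x in generated_subalgebra G].
Proof.
apply/subalg_closedP; split=> [S [/subalg_closedP[] //]|a x y Sx Sy S SG|
  x y Sx Sy S SG]; have [/subalg_closedP[S1 SD SM] _] := SG.
- exact: SD (Sx S SG) (Sy S SG).
- exact: SM (Sx S SG) (Sy S SG).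
Qed.

Lemma generated_ideal_closed (K : pzRingType) (A : lalgType K) (B G : set A) :
  GRing.subalg_closed [pred x in B] -> G `<=` B ->
  two_sided_ideal B (generated_ideal B G).
Proof.
move=> /subalg_closedP[B1 BD BM] GB; split.
(* [B] itself is an ideal containing [G], so it contains the smallest one. *)
- apply: smallest_sub GB; split=> //; last by move=> b x Bb Bx; split; apply: BM.
  have BB x y : B x -> B y -> B (x - y).
    by move=> Bx By; rewrite addrC -scaleN1r; apply: BD.
  by apply/zmod_closedP; split=> //; rewrite -(subrr 1); apply: BB.
- apply/zmod_closedP; split=> [J [[_ /zmod_closedP[] //]]|x y Jx Jy J JG].
  have [[_ /zmod_closedP[_ JB] _] _] := JG.
  exact: JB (Jx J JG) (Jy J JG).
- move=> b x Bb Jx; split=> J JG; have [[_ _ JM] _] := JG;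
    by have [] := JM b x Bb (Jx J JG).
Qed.

(** Serves to group the words of a combination by their extents. *)
Lemma sum_fibers (K : pzRingType) (V : lmodType K) (T T' : eqType)
    (s : seq (K * T)) (f : T -> T') (F : T' -> V) :
  \sum_(a <- s) a.1 *: F (f a.2) =
  \sum_(e <- undup [seq f a.2 | a <- s]) (\sum_(a <- s | f a.2 == e) a.1) *: F e.
Proof.
under [RHS]eq_bigr do rewrite scaler_suml.
rewrite (exchange_big_dep xpredT) //= [LHS]big_seq [RHS]big_seq.
apply: eq_bigr => a sa.
rewrite big_mkcond (bigD1_seq (f a.2)) ?undup_uniq ?mem_undup ?map_f //= eqxx.
by rewrite big1 ?addr0 // => e; rewrite eq_sym => /negPf->.
Qed.

(** * Linearity and multiplicativity of the action *)

Section LinearExtension.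
Variables (K : comNzRingType) (T : choiceType) (V : lmodType K).
Implicit Types (F : T -> V) (x : {malg K[T]}).

(** Both [letter_act] and [act] have this form by conversion, so they inherit linearity from it. *)
Definition linear_extension F x : V := \sum_(k <- msupp x) x@_k *: F k.

Lemma linear_extensionEw (d : {fset T}) F x : (msupp x `<=` d)%fset ->
  linear_extension F x = \sum_(k <- d) x@_k *: F k.
Proof.
move=> le_xd; rewrite [LHS](big_fset_incl _ le_xd) => //= k _ /mcoeff_outdom ->.
by rewrite scale0r.
Qed.

Lemma linear_extension_is_linear F : linear (linear_extension F).
Proof.
move=> a x y; pose d := (msupp x `|` msupp y)%fset.
have le_x : (msupp x `<=` d)%fset by apply: fsubsetUl.
have le_y : (msupp y `<=` d)%fset by apply: fsubsetUr.
have le_axy : (msupp (a *: x + y) `<=` d)%fset.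
  exact: fsubset_trans (msuppD_le _ _) (fsetSU _ (msuppZ_le _ _)).
rewrite !(linear_extensionEw (d := d)) // scaler_sumr -big_split /=.
by apply: eq_bigr => k _; rewrite mcoeffD mcoeffZ scalerDl scalerA.
Qed.

HB.instance Definition _ F := GRing.isLinear.Build K {malg K[T]} V *:%R
  (linear_extension F) (linear_extension_is_linear F).

Lemma linear_extensionU F c k : linear_extension F << c *g k >> = c *: F k.
Proof.
rewrite (linear_extensionEw (d := [fset k]%fset)) ?msuppU_le //.
by rewrite big_seq_fset1 mcoeffUU.
Qed.
End LinearExtension.

(* scalerAr does not apply: a noncommutative {malg K[M]} is only an lalgType. *)
Lemma malg_scalerAr (M : monomType) (K : comNzRingType) (c : K) (x y : {malg K[M]}) :
  x * (c *: y) = c *: (x * y).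
Proof.
rewrite -!mul_malgC !mulrA; congr (_ * _).
rewrite !malgM_def fgmulgU fgmulUg; apply: eq_bigr => k _.
by rewrite mulrC mulm1 mul1m.
Qed.

Section ActionTheory.
Variable K : comNzRingType.

Lemma letter_act_is_linear (x : letter) : linear (@letter_act K x).
Proof. exact: linear_extension_is_linear. Qed.

HB.instance Definition _ x := GRing.isLinear.Build K (CY K) (CY K) *:%R
  (@letter_act K x) (letter_act_is_linear x).

Lemma word_act_is_linear (w : seq letter) : linear (@word_act K w).
Proof. by move=> a u v; elim: w => //= x w ->; rewrite linearP. Qed.

HB.instance Definition _ w := GRing.isLinear.Build K (CY K) (CY K) *:%R
  (@word_act K w) (word_act_is_linear w).

Lemma actE (x : UD K) v :
  act x v = linear_extension (fun w : {fmonom letter} => word_act w v) x.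
Proof. by []. Qed.

Lemma act0 v : act (0 : UD K) v = 0.
Proof. exact: (linear0 (linear_extension _)). Qed.

Lemma actB (x y : UD K) v : act (x - y) v = act x v - act y v.
Proof. exact: (linearB (linear_extension _)). Qed.

Lemma act_is_linear (x : UD K) : linear (act x).
Proof.
move=> a u v; rewrite /act scaler_sumr -big_split /=; apply: eq_bigr => w _.
by rewrite linearP scalerDr !scalerA mulrC.
Qed.

HB.instance Definition _ x := GRing.isLinear.Build K (CY K) (CY K) *:%R
  (act x) (act_is_linear x).

Lemma actM (x y : UD K) v : act (x * y) v = act x (act y v).
Proof.
rewrite malgME actE linear_sum [RHS]/act; apply: eq_bigr => w1 _.
rewrite linear_sum [act y v]/act linear_sum scaler_sumr; apply: eq_bigr => w2 _.
rewrite /= linear_extensionU linearZ scalerA -[mmul w1 w2]/(fmmul w1 w2) fmmulE.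
by rewrite /word_act foldr_cat.
Qed.

Lemma act1 v : act (1 : UD K) v = v.
Proof.
have -> : (1 : UD K) = << FMonom [::] >> by rewrite -fmoneE.
by rewrite actE linear_extensionU scale1r.
Qed.

Lemma act_letter (x : letter) v : act (<< fmu x >> : UD K) v = letter_act x v.
Proof. by rewrite actE linear_extensionU scale1r fmuE. Qed.

Lemma annihilatorP (x : UD K) :
  annihilator K x <-> forall l : int_partition, act x << l >> = 0.
Proof.
split=> [x0 l|x0 v]; first exact: x0.
rewrite [v]monalgE linear_sum big1 // => l _.
have -> : << v@_l *g l >> = v@_l *: << l >> :> CY K.
  by apply/malgP => k; rewrite mcoeffZ !mcoeffU mulrnAr mulr1.
by rewrite linearZ /= x0 scaler0.
Qed.

(** * The subalgebra B and the ideal J *)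

Variable t : column.

Definition generator (b : bool) : UD K := if b then u K t else d K t.

Definition monomial (w : seq bool) : UD K := \prod_(b <- w) generator b.

Lemma monomial_cat w1 w2 : monomial (w1 ++ w2) = monomial w1 * monomial w2.
Proof. exact: big_cat. Qed.

Lemma monomial_cons b w : monomial (b :: w) = generator b * monomial w.
Proof. exact: big_cons. Qed.

Lemma monomial_nseq n b : monomial (nseq n b) = generator b ^+ n.
Proof.
elim: n => [|n IHn]; first by rewrite [LHS]big_nil.
by rewrite [nseq _ _]/= monomial_cons IHn exprS.
Qed.

Lemma act_generator b l : act (generator b) << l >> =
  oapp (fun m => << m >> : CY K) 0 (step t b l).
Proof.
have -> : act (generator b) << l >>
    = xget 0 [set (<< m >> : CY K) | m in box_move t b l].
  by case: b; rewrite act_letter [LHS]linear_extensionU scale1r.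
case Eb: (step t b l) => [m|] /=.
  have /stepP lm := Eb; apply: xget_unique => [|_ [m' lm' <-]]; first by exists m.
  by rewrite (box_move_unique lm lm').
by apply: xgetPN => v [m /stepP lm _]; rewrite lm in Eb.
Qed.

Lemma act_monomial w l : act (monomial w) << l >> =
  oapp (fun m => << m >> : CY K) 0 (walk t w l).
Proof.
elim: w => [|b w IHw]; first by rewrite [monomial _]big_nil act1.
rewrite monomial_cons actM IHw /=.
by case: (walk t w l) => [m|] /=; rewrite ?act_generator ?linear0.
Qed.

Lemma subalgB_closed :
  [/\ subalgB K t 1,
      (forall a x y, subalgB K t x -> subalgB K t y -> subalgB K t (a *: x + y))
    & (forall x y, subalgB K t x -> subalgB K t y -> subalgB K t (x * y))].
Proof. exact/subalg_closedP/generated_subalgebra_closed. Qed.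

Lemma subalgB_monomial w : subalgB K t (monomial w).
Proof.
have [B1 _ BM] := subalgB_closed.
elim: w => [|b w IHw]; first by rewrite [monomial _]big_nil.
rewrite monomial_cons; apply: BM IHw.
by apply: sub_gen_smallest; case: b; [left|right].
Qed.

(** Products of words are concatenations, so the combinations of words form a subalgebra, and it
    contains both generators. *)
Lemma subalgB_span x : subalgB K t x ->
  exists s : seq (K * seq bool), x = \sum_(a <- s) a.1 *: monomial a.2.
Proof.
pose span := [set y | exists s : seq (K * seq bool),
  y = \sum_(a <- s) a.1 *: monomial a.2].
suff : subalgB K t `<=` span by apply.
apply: smallest_sub => [|y].
  apply/subalg_closedP; split=> [|c _ _ [s1 ->] [s2 ->]|_ _ [s1 ->] [s2 ->]].
  - by exists [:: (1, [::])]; rewrite big_seq1 scale1r [RHS]big_nil.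
  - exists ([seq (c * a.1, a.2) | a <- s1] ++ s2).
    rewrite big_cat big_map scaler_sumr /=.
    by under eq_bigr do rewrite scalerA.
  - exists [seq (a.1 * b.1, a.2 ++ b.2) | a <- s1, b <- s2].
    rewrite big_allpairs_dep mulr_suml; apply: eq_bigr => a _.
    rewrite mulr_sumr; apply: eq_bigr => b _ /=.
    by rewrite monomial_cat -scalerAl malg_scalerAr scalerA.
by case=> ->; [exists [:: (1, [:: true])]|exists [:: (1, [:: false])]];
  rewrite big_seq1 scale1r [RHS]big_seq1.
Qed.

Lemma relations_monomial x : relations K t x <-> exists i : nat,
     x = monomial (ups i.+1 ++ downs i)
         - monomial (ups i.+1 ++ downs i.+1 ++ [:: true])
  \/ x = monomial (ups i ++ downs i.+1)
         - monomial ([:: false] ++ ups i.+1 ++ downs i.+1).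
Proof.
split=> -[i xE]; exists i; move: xE; rewrite !monomial_cat !monomial_nseq.
  by rewrite ![monomial [:: _]]big_seq1 !mulrA.
by rewrite ![monomial [:: _]]big_seq1 !mulrA.
Qed.

Lemma subalgB_sub x y : subalgB K t x -> subalgB K t y -> subalgB K t (x - y).
Proof.
by move=> Bx By; rewrite addrC -scaleN1r; have [_ BD _] := subalgB_closed; apply: BD.
Qed.

Lemma annihilator_monomial_sub w1 w2 :
  (forall l, walk t w1 l = walk t w2 l) ->
  annihilator K (monomial w1 - monomial w2).
Proof.
move=> eq_w; apply/annihilatorP => l.
by rewrite actB !act_monomial eq_w subrr.
Qed.

Lemma relations_sub_annihilator : relations K t `<=` annihilator K.
Proof.
move=> x /relations_monomial[i [->|->]]; apply: annihilator_monomial_sub => l.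
  exact: walk_r_up.
exact: walk_r_down.
Qed.

Lemma relations_sub_subalgB : relations K t `<=` subalgB K t.
Proof.
by move=> x /relations_monomial[i [->|->]]; apply: subalgB_sub;
  apply: subalgB_monomial.
Qed.

Lemma annihilator_two_sided_ideal :
  two_sided_ideal (subalgB K t) (annihilator K `&` subalgB K t).
Proof.
have [B1 BD BM] := subalgB_closed.
split=> [x []//||b x Bb [x0 Bx]].
  apply/zmod_closedP; split=> [|x y [x0 Bx] [y0 By]].
    split=> [v|]; first by rewrite act0.
    by rewrite -(subrr 1); apply: subalgB_sub.
  split=> [v|]; last exact: subalgB_sub.
  by rewrite actB x0 y0 subrr.
split; split; try exact: BM; move=> v.
  by rewrite actM x0 linear0.
by rewrite actM x0.
Qed.

Let J := generated_ideal (subalgB K t) (relations K t).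

Let J_ideal : two_sided_ideal (subalgB K t) J.
Proof.
apply: generated_ideal_closed relations_sub_subalgB.
exact: generated_subalgebra_closed.
Qed.

Lemma generated_ideal_sub_annihilator : J `<=` annihilator K `&` subalgB K t.
Proof.
apply: smallest_sub annihilator_two_sided_ideal _ => x xrel.
by split; [apply: relations_sub_annihilator|apply: relations_sub_subalgB].
Qed.

Let J0 : J 0.
Proof. by have [_ /zmod_closedP[]] := J_ideal. Qed.

Let JB x y : J x -> J y -> J (x - y).
Proof. by have [_ /zmod_closedP[_ JB] _] := J_ideal; apply: JB. Qed.

Let JD x y : J x -> J y -> J (x + y).
Proof. by move=> Jx Jy; rewrite -[y]opprK -[- y]add0r; apply: JB (JB _ _). Qed.

Let JZ c x : J x -> J (c *: x).
Proof.
have [B1 BD _] := subalgB_closed; have [_ _ JM] := J_ideal => Jx.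
(* An ideal absorbs products with elements of B, so the scalar is turned into the element c 1 of
   B. *)
rewrite -[x]mul1r scalerAl; apply: (JM _ _ _ Jx).1.
rewrite -[_ *: _]addr0; apply: BD => //.
by rewrite -(subrr 1); apply: subalgB_sub.
Qed.

(** Congruence modulo J is an equivalence compatible with concatenation, and the generators of J
    give [r_up] and [r_down]. *)
Lemma J_canonical_word w :
  J (monomial w - monomial (canonical_word (extent w))).
Proof.
pose r w1 w2 := J (monomial w1 - monomial w2).
apply: (@r_canonical_word r) => [||i|i].
- split=> [w1|w1 w2|w1 w2 w3]; rewrite /r ?subrr //.
    by rewrite -[monomial w2 - _]opprB -sub0r; apply: JB.
  by move=> r12 r23; have := JD r12 r23; rewrite subrKA.
- move=> w1 w1' r1 w2 w2' r2; rewrite /r !monomial_cat.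
  have [_ _ JM] := J_ideal.
  have [_ J1] := JM _ _ (subalgB_monomial w2) r1.
  have [J2 _] := JM _ _ (subalgB_monomial w1') r2.
  by have := JD J1 J2; rewrite mulrBl mulrBr subrKA.
- by apply: sub_gen_smallest; apply/relations_monomial; exists i; left.
- by apply: sub_gen_smallest; apply/relations_monomial; exists i; right.
Qed.

(** * Vanishing of coefficients and the reverse inclusion *)

Hypothesis ht : (1 < sval t)%N.

(** Words of equal extent act alike on near rectangles, which therefore see a combination only
    through these sums. *)
Lemma coefficients_zero (s : seq (K * seq bool)) :
  annihilator K (\sum_(a <- s) a.1 *: monomial a.2) ->
  forall e, \sum_(a <- s | extent a.2 == e) a.1 = 0.
Proof.
move=> s0; pose r := undup [seq extent a.2 | a <- s].
pose coef e := \sum_(a <- s | extent a.2 == e) a.1.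
have coef_out e : e \notin r -> coef e = 0.
  rewrite mem_undup => /negP er; rewrite /coef big_seq_cond big1 // => a.
  by case/andP => sa /eqP ae; case: er; rewrite -ae (map_f (extent \o snd)).
pose shift b N (e : nat * nat * nat) : CY K := let: (p, h, n) := e in
  if (p <= b)%N && (b + n <= N + p)%N then << near_rectangle ht (b - p + h) N >>
  else 0.
have shift_sum b N : (b <= N)%N -> \sum_(e <- r) coef e *: shift b N e = 0.
  move=> lebN; rewrite -(sum_fibers s extent (shift b N)).
  have := s0 << near_rectangle ht b N >>; rewrite actE linear_sum /= => s0b.
  rewrite -[RHS]s0b; apply: eq_bigr => a _.
  rewrite linearZ /= -actE act_monomial walk_near_rectangle //; congr (_ *: _).
  by case: (extent a.2) => [[p h] n] /=; case: ifP.
(* Strong induction on n replaces the choice of a term with n minimal. *)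
have coef0 m p h n : (n < m)%N -> coef (p, h, n) = 0.
  elim: m p h n => // m IHm p h n; rewrite ltnS => lenm.
  have [er|/coef_out//] := boolP ((p, h, n) \in r).
  have /andP[lepn lehn] : (p <= n)%N && (h <= n)%N.
    move: er; rewrite mem_undup => /mapP[a _ eE].
    by have := extent_bounds a.2; rewrite -eE.
  (* With b = p and N = n the path just fits: it touches both 0 and n, and it ends at h. *)
  have := shift_sum p n lepn => /(congr1 (mcoeff (near_rectangle ht h n))).
  rewrite mcoeff0 raddf_sum (bigD1_seq (p, h, n)) ?undup_uniq //=.
  rewrite leqnn addnC leqnn subnn add0n mcoeffZ mcoeffUU mulr1 big1 ?addr0 //.
  move=> [[p' h'] n'] ne; rewrite mcoeffZ /=; case: ifP => [|_]; last first.
    by rewrite mcoeff0 mulr0.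
  move=> /andP[lep'p le_n]; rewrite mcoeffU.
  case: eqP => [/near_rectangle_inj eh|_]; last by rewrite mulr0.
  (* From p' <= p and p + n' <= n + p', either n' < n and induction applies, or n' = n, p' = p and
     then h' = h. *)
  have [lt_n'|ge_n'] := ltnP n' n; last first.
    case/eqP: ne; congr (_, _, _); lia.
  by rewrite IHm ?mul0r //; lia.
by move=> [[p h] n]; exact: coef0 (ltnSn n).
Qed.

Lemma annihilator_sub_generated_ideal : annihilator K `&` subalgB K t `<=` J.
Proof.
move=> x [x0 /subalgB_span[s xE]]; rewrite xE in x0 *.
have canonical0 :
    \sum_(a <- s) a.1 *: monomial (canonical_word (extent a.2)) = 0.
  rewrite (sum_fibers s extent (fun e => monomial (canonical_word e))).
  by rewrite big1 // => e _; rewrite (coefficients_zero x0) scale0r.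
(* Subtracting this zero sum leaves a combination of differences between a word and its canonical
   form, each in J. *)
rewrite -[X in J X]subr0 -[X in J (_ - X)]canonical0 -sumrB.
elim/big_rec: _ => [|a y _ Jy]; first exact: J0.
apply: JD Jy; rewrite -scalerBr.
exact: JZ (J_canonical_word _).
Qed.

Lemma annihilator_subalgBE :
  annihilator K `&` subalgB K t = generated_ideal (subalgB K t) (relations K t).
Proof.
apply/seteqP; split; first exact: annihilator_sub_generated_ideal.
exact: generated_ideal_sub_annihilator.
Qed.
End ActionTheory.

Theorem theorem4p9 (R : realType) (t : column) (ht : (1 < sval t)%N) :
  (annihilator R[i] `&` subalgB R[i] t)%classic
    = generated_ideal (subalgB R[i] t) (relations R[i] t).
Proof. exact: annihilator_subalgBE. Qed.
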